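(* Let $(a,b)=(z,\,z^2+z+1)\in(\mathbb{F}_2[z]\setminus\mathbb{F}_2)^2$. Let $\mathbf{t}$ be the $(a,b)$-Thue-Morse sequence and $\bar{\mathbf{t}}$ the $(b,a)$-Thue-Morse sequence. The two power series $\mathrm{CF}(\mathbf{t}(z))$ and $\mathrm{CF}(\bar{\mathbf{t}}(z))$ in $\mathbb{F}_2((1/z))$ are algebraic over $\mathbb{F}_2(z)$, with minimal polynomials of the form $$p_4(z)y^4+p_3(z)y^3+p_2(z)y^2+p_1(z)y+p_0(z)=0.$$ For $\mathrm{CF}(\mathbf{t}(z))$: \begin{align*} p_0(z)&=z^9+z^7+z^6+z^5+z^4+z+1,\\ p_1(z)&=z^{11}+z^{10}+z^8+z^6+z^5+z^3+z^2+z,\\ p_2(z)&=z^{12}+z^{10}+z^2,\\ p_3(z)&=z^{11}+z^{10}+z^8+z^6+z^5+z^3+z^2+z,\\ p_4(z)&=z^{10}+z^9+z^7+z^6+z^5+z^2+z, \end{align*} and for $\mathrm{CF}(\bar{\mathbf{t}}(z))$: \begin{align*} p_0(z)&=z^9+z^8+z^7+z^6+z^5+z^4+z,\\ p_1(z)&=z^{11}+z^{10}+z^8+z^6+z^5+z^3+z^2+z,\\ p_2(z)&=z^{12}+z^{10}+z^2,\\ p_3(z)&=z^{11}+z^{10}+z^8+z^6+z^5+z^3+z^2+z,\\ p_4(z)&=z^{10}+z^9+z^8+z^7+z^6+z^5+z^2+z+1. \end{align*}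
   Context: For two distinct elements $a,b$ of an alphabet, the $(a,b)$-Thue-Morse sequence is the fixed point $s^\infty(a)$ (starting with $a$) of the substitution $s: a\mapsto ab,\ b\mapsto ba$. For a field $K$ and a sequence $\mathbf{a}(z)=(a_j(z))_{j\ge0}$ of polynomials in $K[z]\setminus K$, the continued fraction $$\mathrm{CF}(\mathbf{a}(z))=\cfrac{1}{a_0(z)+\cfrac{1}{a_1(z)+\cfrac{1}{a_2(z)+\cdots}}}$$ is the limit in $K((1/z))$ (which exists) of the finite continued fractions $$\mathrm{CF}_n(\mathbf{a}(z))=\cfrac{1}{a_0(z)+\cfrac{1}{a_1(z)+\cfrac{1}{\ddots+\cfrac{1}{a_n(z)}}}}\,.$$ Rational fractions are expanded in powers of $1/z$. Minimal polynomials are not normalized to be monic: ''minimal polynomial'' means an irreducible annihilating polynomial over $\mathbb{F}_2(z)$, determined up to a nonzero factor in $\mathbb{F}_2(z)$. *)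

(* Defs.v *)
From HB Require Import structures.
From mathcomp Require Import all_boot all_order all_algebra.
From mathcomp Require Import boolp classical_sets functions cardinality fsbigop.
From mathcomp Require Import zify.

Set Implicit Arguments.
Unset Strict Implicit.
Unset Printing Implicit Defensive.

Import Order.TTheory GRing.Theory Num.Theory.
Local Open Scope ring_scope.

Local Notation "x %:F" := (@FracField.tofrac _ x).

(** * The field [K((1/z))] *)

(* [lcoef f n] is the coefficient of [z ^ n], [n : int]; the series has finitely
   many positive powers of [z]. *)
Record laurent (K : fieldType) : Type := Laurent {
  lcoef :> int -> K;
  lcoef_bounded : exists N : int, forall n : int, N < n -> lcoef n = 0
}.

HB.instance Definition _ (K : fieldType) := gen_eqMixin (laurent K).
HB.instance Definition _ (K : fieldType) := gen_choiceMixin (laurent K).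

Section LaurentRing.
Variable K : fieldType.
Implicit Types f g h : laurent K.
Implicit Types (a b c n N : int) (k i j M : nat).

Definition deg_le N f := forall n, N < n -> f n = 0.

Lemma laurentP f g : (forall n, f n = g n) -> f = g.
Proof.
case: f g => [f bf] [g bg] /= /funext fg; rewrite fg in bf *.
by congr Laurent; exact: Prop_irrelevance.
Qed.

Lemma deg_le_ex f : exists N, deg_le N f.
Proof. by case: f. Qed.

Lemma deg_leW N N' f : N <= N' -> deg_le N f -> deg_le N' f.
Proof. by move=> NN' fN n lt; apply: fN; apply: le_lt_trans lt. Qed.

Fact lzero_subproof : exists N, forall n, N < n -> (fun=> 0 : K) n = 0.
Proof. by exists 0. Qed.
Definition lzero := Laurent lzero_subproof.

Fact lone_subproof : exists N, forall n, N < n -> ((n == 0)%:R : K) = 0.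
Proof. by exists 0 => n; case: eqP => // ->; rewrite ltxx. Qed.
Definition lone := Laurent lone_subproof.

Fact lopp_subproof f : exists N, forall n, N < n -> - f n = 0.
Proof. by have [N fN] := deg_le_ex f; exists N => n /fN ->; rewrite oppr0. Qed.
Definition lopp f := Laurent (lopp_subproof f).

Fact ladd_subproof f g : exists N, forall n, N < n -> f n + g n = 0.
Proof.
have [N fN] := deg_le_ex f; have [N' gN] := deg_le_ex g.
by exists (Num.max N N') => n; rewrite gt_max => /andP[/fN-> /gN->]; rewrite addr0.
Qed.
Definition ladd f g := Laurent (ladd_subproof f g).

(* Only finitely many terms are nonzero, so that the finitely supported sum of
   [fsbigop] is the full Cauchy product. *)
Definition lcauchy f g n : K := \sum_(i \in [set: int]) f i * g (n - i).

Lemma lcauchy_deg a b f g n : deg_le a f -> deg_le b g -> a + b < n ->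
  lcauchy f g n = 0.
Proof.
move=> fa gb lt; rewrite /lcauchy fsbig1 // => i _.
have [/fa->|le] := ltP a i; first by rewrite mul0r.
by rewrite gb ?mulr0 //; lia.
Qed.

Lemma lcauchyE a b f g k : deg_le a f -> deg_le b g ->
  lcauchy f g (a + b - k%:Z) = \sum_(i < k.+1) f (a - i%:Z) * g (b - (k - i)%:Z).
Proof.
move=> fa gb; pose s := [seq a - i%:Z | i <- iota 0 k.+1].
have us : uniq s.
  by rewrite map_inj_uniq ?iota_uniq // => i j /addrI/oppr_inj[].
rewrite /lcauchy -(@fsbig_widen _ _ 0 +%R [set` s]) //.
  rewrite -fsbig_seq // big_map -[iota _ _]/(index_iota 0 k.+1) big_mkord.
  by apply: eq_bigr => i _; congr (_ * g _); have := ltn_ord i; lia.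
move=> i [_ sNi] /=.
have [/fa->|le] := ltP a i; first by rewrite mul0r.
rewrite gb ?mulr0 //; rewrite ltNge; apply/negP => le2; apply: sNi => /=.
apply/mapP; exists `|a - i|%N; last by lia.
by rewrite mem_iota; lia.
Qed.

Fact lmul_subproof f g : exists N, forall n, N < n -> lcauchy f g n = 0.
Proof.
have [a fa] := deg_le_ex f; have [b gb] := deg_le_ex g.
by exists (a + b) => n; exact: lcauchy_deg.
Qed.
Definition lmul f g := Laurent (lmul_subproof f g).

Lemma lmul_deg a b f g : deg_le a f -> deg_le b g -> deg_le (a + b) (lmul f g).
Proof. by move=> fa gb n; exact: lcauchy_deg. Qed.

Lemma lmulE a b f g k : deg_le a f -> deg_le b g ->
  lmul f g (a + b - k%:Z) = \sum_(i < k.+1) f (a - i%:Z) * g (b - (k - i)%:Z).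
Proof. exact: lcauchyE. Qed.

Lemma laurentP_deg a f g : deg_le a f -> deg_le a g ->
  (forall k, f (a - k%:Z) = g (a - k%:Z)) -> f = g.
Proof.
move=> fa ga fg; apply: laurentP => n.
have [lt|le] := ltP a n; first by rewrite fa // ga.
by have := fg `|a - n|%N; rewrite (_ : a - _ = n) //; lia.
Qed.

Lemma laddA : associative ladd.
Proof. by move=> f g h; apply: laurentP => n /=; rewrite addrA. Qed.
Lemma laddC : commutative ladd.
Proof. by move=> f g; apply: laurentP => n /=; rewrite addrC. Qed.
Lemma ladd0 : left_id lzero ladd.
Proof. by move=> f; apply: laurentP => n /=; rewrite add0r. Qed.
Lemma laddN : left_inverse lzero lopp ladd.
Proof. by move=> f; apply: laurentP => n /=; rewrite addNr. Qed.

HB.instance Definition _ :=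
  GRing.isZmodule.Build (laurent K) laddA laddC ladd0 laddN.

Let trunc a M f : {poly K} := \poly_(i < M) f (a - i%:Z).

Let lmul_trunc a b f g k M : deg_le a f -> deg_le b g -> (k < M)%N ->
  lmul f g (a + b - k%:Z) = (trunc a M f * trunc b M g)`_k.
Proof.
move=> fa gb kM; rewrite (lmulE k fa gb) coefM; apply: eq_bigr => i _.
by rewrite !coef_poly !ifT //; have := ltn_ord i; lia.
Qed.

Let coefM_congr (p p' q q' : {poly K}) k :
  (forall i, (i <= k)%N -> p`_i = p'`_i) -> (forall i, (i <= k)%N -> q`_i = q'`_i) ->
  (p * q)`_k = (p' * q')`_k.
Proof.
move=> pp qq; rewrite !coefM; apply: eq_bigr => i _.
by rewrite pp ?qq //; have := ltn_ord i; lia.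
Qed.

Let trunc_lmul a b f g k M : deg_le a f -> deg_le b g -> (k < M)%N ->
  (trunc (a + b) M (lmul f g))`_k = (trunc a M f * trunc b M g)`_k.
Proof. by move=> fa gb kM; rewrite coef_poly kM; exact: lmul_trunc. Qed.

Lemma lmulA : associative lmul.
Proof.
move=> f g h; have [[a fa] [b gb] [c hc]] :=
  And3 (deg_le_ex f) (deg_le_ex g) (deg_le_ex h).
have fg := lmul_deg fa gb; have gh := lmul_deg gb hc.
apply: (@laurentP_deg (a + b + c)); first by rewrite -addrA; exact: lmul_deg.
  exact: lmul_deg.
move=> k; rewrite (lmul_trunc fg hc (ltnSn k)) -[a + b + c]addrA.
rewrite (lmul_trunc fa gh (ltnSn k)).
transitivity ((trunc a k.+1 f * (trunc b k.+1 g * trunc c k.+1 h))`_k).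
  by apply: coefM_congr => // i le; exact: trunc_lmul.
by rewrite mulrA; apply: coefM_congr => // i le; rewrite trunc_lmul.
Qed.

Lemma lmulC : commutative lmul.
Proof.
move=> f g; have [a fa] := deg_le_ex f; have [b gb] := deg_le_ex g.
apply: (@laurentP_deg (a + b)); first exact: lmul_deg.
  by rewrite addrC; exact: lmul_deg.
move=> k; rewrite (lmul_trunc fa gb (ltnSn k)) mulrC [a + b]addrC.
by rewrite (lmul_trunc gb fa (ltnSn k)).
Qed.

Lemma deg_le1 : deg_le 0 lone.
Proof. by move=> n /=; case: eqP => // ->; rewrite ltxx. Qed.

Lemma lmul1 : left_id lone lmul.
Proof.
move=> f; have [a fa] := deg_le_ex f.
apply: (@laurentP_deg (0 + a)); [exact: lmul_deg deg_le1 fa | by rewrite add0r |].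
move=> k; rewrite (lmulE k deg_le1 fa) big_ord_recl big1 => [|i _].
  by rewrite /= mul1r addr0 subn0 add0r.
have -> : lone (0 - (lift ord0 i)%:Z) = 0 
  by rewrite -[LHS]/((0 - (lift ord0 i)%:Z == 0)%:R) lift0 sub0r oppr_eq0.
by rewrite mul0r.
Qed.

Lemma ladd_deg a f g : deg_le a f -> deg_le a g -> deg_le a (ladd f g).
Proof. by move=> fa ga n lt /=; rewrite fa // ga // addr0. Qed.

Lemma lmulDl : left_distributive lmul ladd.
Proof.
move=> f g h; have [[a fa] [b gb] [c hc]] :=
  And3 (deg_le_ex f) (deg_le_ex g) (deg_le_ex h).
pose m := Num.max a b.
have {}fa : deg_le m f by apply: deg_leW fa; rewrite le_max lexx.
have {}gb : deg_le m g by apply: deg_leW gb; rewrite le_max lexx orbT.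
have fg := ladd_deg fa gb.
apply: (@laurentP_deg (m + c)); first exact: lmul_deg.
  by apply: ladd_deg; exact: lmul_deg.
move=> k; rewrite (lmulE k fg hc).
rewrite -[RHS]/(lmul f h _ + lmul g h _) (lmulE k fa hc) (lmulE k gb hc).
by rewrite -big_split; apply: eq_bigr => i _ /=; rewrite mulrDl.
Qed.

Lemma lone_neq0 : lone != 0.
Proof.
apply/eqP => /(congr1 (fun f : laurent K => f 0)) /eqP.
by rewrite -[lone 0]/(1 : K) -[(0 : laurent K) 0]/(0 : K) oner_eq0.
Qed.

HB.instance Definition _ :=
  GRing.Zmodule_isComNzRing.Build (laurent K) lmulA lmulC lmul1 lmulDl lone_neq0.


Lemma laurent_deg f : f != 0 -> exists2 a, deg_le a f & f a != 0.
Proof.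
move=> f0; have [N fN] := deg_le_ex f.
have [exk|fk] := pselect (exists k, f (N - k%:Z) != 0); last first.
  case/eqP: f0; apply: (@laurentP_deg N) => // k; apply/eqP/negPn/negP => nz.
  by case: fk; exists k.
have [k fk mink] := ex_minnP exk; exists (N - k%:Z) => // n lt.
have [/fN//|le] := ltP N n.
apply/eqP/negPn/negP => nz; have := mink `|N - n|%N.
by rewrite (_ : N - _ = n); [move=> /(_ nz); lia | lia].
Qed.

Let linv_seq (F : nat -> K) := fix s (n : nat) : seq K := if n is m.+1
  then rcons (s m) ((F 0%N)^-1 *
    ((m == 0%N)%:R - \sum_(i < m) F i.+1 * nth 0 (s m) (m - i.+1)))
  else [::].

Let linv_seqP (F : nat -> K) : F 0%N != 0 ->
  exists G : nat -> K, forall k, \sum_(i < k.+1) F i * G (k - i)%N = (k == 0%N)%:R.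
Proof.
move=> F0; pose G (i : nat) := nth 0 (linv_seq F i.+1) i.
have sz (n : nat) : size (linv_seq F n) = n by elim: n => //= n IH; rewrite size_rcons IH.
have GE (n i : nat) : (i < n)%N -> nth 0 (linv_seq F n) i = G i.
  elim: n => // n IH; rewrite ltnS leq_eqVlt => /orP[/eqP->//|lt].
  by rewrite /= nth_rcons sz lt IH.
exists G => k; rewrite big_ord_recl subn0 /G /= nth_rcons sz ltnn eqxx.
rewrite mulVKf // -addrA [X in _ + X](_ : _ = 0) ?addr0 //.
apply/eqP; rewrite addrC subr_eq0; apply/eqP/eq_bigr => i _.
by rewrite GE //= /bump /=; have := ltn_ord i; lia.
Qed.

Lemma laurent_unit f : f != 0 -> exists g, f * g = 1.
Proof.
move=> /laurent_deg[a fa nz].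
have [|G GP] := @linv_seqP (fun k => f (a - k%:Z)); first by rewrite subr0.
pose g n := if n <= - a then G `|- a - n|%N else 0.
have bg : exists N, forall n, N < n -> g n = 0.
  by exists (- a) => n; rewrite /g leNgt => ->.
have gd : deg_le (- a) (Laurent bg) by move=> n; rewrite /= /g leNgt => ->.
exists (Laurent bg); apply: (@laurentP_deg (a - a)); first exact: lmul_deg.
  by rewrite subrr; exact: deg_le1.
move=> k; rewrite (lmulE k fa gd) /= subrr sub0r oppr_eq0.
rewrite -[RHS]GP; apply: eq_bigr => i _; congr (_ * _).
by rewrite /g ifT; [congr G; lia | lia].
Qed.

Definition linv f : laurent K := xget 0 [set g | f * g = 1]%classic.

Lemma lmulV f : f != 0 -> linv f * f = 1.
Proof. by move=> /laurent_unit/(xgetPex 0); rewrite mulrC. Qed.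

Lemma linv0 : linv 0 = 0.
Proof.
rewrite /linv; case: xgetP => // g _ /= /eqP.
by rewrite mul0r eq_sym oner_eq0.
Qed.

HB.instance Definition _ := GRing.ComNzRing_isField.Build (laurent K) lmulV linv0.

(** ** Rational fractions as series in [1/z] *)

Fact poly_laurent_subproof (p : {poly K}) : exists N, forall n, N < n ->
  (if n is Posz k then p`_k else 0) = 0.
Proof.
by exists (size p)%:Z => -[k|//]; rewrite ltz_nat => /ltnW le; rewrite nth_default.
Qed.
Definition poly_laurent p : laurent K := Laurent (poly_laurent_subproof p).

Lemma poly_laurent_is_zmod_morphism : zmod_morphism poly_laurent.
Proof.
by move=> p q; apply: laurentP => -[k|k] /=; rewrite ?coefB // subr0.
Qed.

Lemma poly_laurent_deg (p : {poly K}) M : (size p <= M.+1)%N -> deg_le M%:Z (poly_laurent p).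
Proof.
by move=> le [k|//]; rewrite ltz_nat => lt; apply: nth_default; exact: leq_trans lt.
Qed.

Lemma poly_laurent_is_monoid_morphism : monoid_morphism poly_laurent.
Proof.
split; first by apply: laurentP => -[k|k] //=; rewrite coef1.
move=> p q; apply: laurentP => n.
rewrite -[RHS]/(lcauchy (poly_laurent p) (poly_laurent q) n) /lcauchy.
case: n => n; last first.
  rewrite fsbig1 // => -[i _|i _] /=; last by rewrite mul0r.
  by rewrite (_ : Negz n - i%:Z = Negz (n + i)) ?mulr0 //; lia.
pose s := [seq Posz i | i <- iota 0 n.+1].
have us : uniq s by rewrite map_inj_uniq ?iota_uniq // => i j [].
rewrite -(@fsbig_widen _ _ 0 +%R [set` s]) //.
  rewrite -fsbig_seq // big_map -[iota _ _]/(index_iota 0 n.+1) big_mkord /= coefM.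
  apply: eq_bigr => i _; have := ltn_ord i; rewrite ltnS => le.
  by rewrite -[Posz n - _]/(n%:Z - i%:Z) subzn.
move=> [i|i] [_ sNi] /=; last by rewrite mul0r.
have [le|lt] := leqP i n.
  by case: sNi => /=; rewrite map_f // mem_iota.
by rewrite (_ : n%:Z - i%:Z = Negz (i - n.+1)) ?mulr0 //; lia.
Qed.

HB.instance Definition _ := GRing.isZmodMorphism.Build {poly K} (laurent K)
  poly_laurent poly_laurent_is_zmod_morphism.
HB.instance Definition _ := GRing.isMonoidMorphism.Build {poly K} (laurent K)
  poly_laurent poly_laurent_is_monoid_morphism.

Lemma poly_laurent_eq0 p : (poly_laurent p == 0) = (p == 0).
Proof.
apply/eqP/eqP => [p0|->]; last exact: rmorph0.
by apply/polyP => i; rewrite coef0 -[LHS]/(poly_laurent p i%:Z) p0.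
Qed.

Local Open Scope quotient_scope.

Definition frac_laurent (x : {fraction {poly K}}) : laurent K :=
  poly_laurent \n_(repr x) / poly_laurent \d_(repr x).

Lemma frac_laurent_Ratio p q : q != 0 ->
  frac_laurent (\pi_{fraction {poly K}} (Ratio p q)) =
  poly_laurent p / poly_laurent q.
Proof.
move=> q0; rewrite /frac_laurent; set r := Ratio p q.
apply/eqP; rewrite eqr_div ?poly_laurent_eq0 ?denom_ratioP // -!rmorphM.
have := FracField.equivf_r r; rewrite /r !numden_Ratio // => ->.
by rewrite mulrC.
Qed.

Lemma frac_ratio (p q : {poly K}) : q != 0 ->
  \pi_{fraction {poly K}} (Ratio p q) = p%:F / q%:F.
Proof.
move=> q0; rewrite -[_^-1]/(FracField.inv _) -[RHS]/(FracField.mul _ _).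
unlock FracField.tofrac; rewrite -[FracField.inv _]FracField.pi_inv.
rewrite -[RHS]FracField.pi_mul /FracField.invf /FracField.mulf.
by rewrite !numden_Ratio ?oner_neq0 ?mulr1 ?mul1r.
Qed.

Lemma frac_laurentE (p q : {poly K}) : q != 0 ->
  frac_laurent (p%:F / q%:F) = poly_laurent p / poly_laurent q.
Proof. by move=> q0; rewrite -frac_ratio // frac_laurent_Ratio. Qed.

Lemma fracP (x : {fraction {poly K}}) :
  exists p q : {poly K}, q != 0 /\ x = p%:F / q%:F.
Proof.
exists \n_(repr x), \d_(repr x); split; first exact: denom_ratioP.
by rewrite -frac_ratio ?denom_ratioP // Ratio_numden reprK.
Qed.

Lemma frac_laurent_is_zmod_morphism : zmod_morphism frac_laurent.
Proof.
move=> x y; have [p [q [q0 ->]]] := fracP x; have [r [s [s0 ->]]] := fracP y.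
rewrite -mulNr addf_div ?tofrac_eq0 // -!(rmorphM, rmorphN, rmorphD).
rewrite !frac_laurentE ?mulf_neq0 // -mulNr addf_div ?poly_laurent_eq0 //.
by rewrite !(rmorphM, rmorphN, rmorphD).
Qed.

Lemma frac_laurent_poly (p : {poly K}) : frac_laurent p%:F = poly_laurent p.
Proof.
by rewrite -[p%:F]divr1 -(rmorph1 (@FracField.tofrac {poly K})) frac_laurentE ?oner_neq0 // rmorph1 divr1.
Qed.

Lemma frac_laurent_is_monoid_morphism : monoid_morphism frac_laurent.
Proof.
split; first by rewrite -[1](rmorph1 (@FracField.tofrac {poly K})) frac_laurent_poly rmorph1.
move=> x y; have [p [q [q0 ->]]] := fracP x; have [r [s [s0 ->]]] := fracP y.
rewrite mulf_div -!rmorphM !frac_laurentE ?mulf_neq0 // mulf_div.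
by rewrite !rmorphM.
Qed.

HB.instance Definition _ := GRing.isZmodMorphism.Build {fraction {poly K}}
  (laurent K) frac_laurent frac_laurent_is_zmod_morphism.
HB.instance Definition _ := GRing.isMonoidMorphism.Build {fraction {poly K}}
  (laurent K) frac_laurent frac_laurent_is_monoid_morphism.

End LaurentRing.

(** * Convergence in [K((1/z))] and continued fractions *)

Section ContinuedFraction.
Variable K : fieldType.
Implicit Types (f g y : laurent K) (a : nat -> {poly K}) (n m : nat).

(* The topology of the valuation [- deg]: [u n - y] has arbitrarily small degree,
   eventually.  (Coefficientwise convergence would be strictly weaker.) *)
Definition laurent_cvg (u : nat -> laurent K) (y : laurent K) : Prop :=
  forall N : int, exists n0 : nat, forall n : nat, (n0 <= n)%N -> deg_le N (u n - y).

Lemma laurent_cvg_unique u y y' : laurent_cvg u y -> laurent_cvg u y' -> y = y'.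
Proof.
move=> uy uy'; apply: laurentP => k.
have [n uyn] := uy (k - 1); have [n' uyn'] := uy' (k - 1).
have lt : k - 1 < k by lia.
have := uyn _ (leq_maxl n n') _ lt; have := uyn' _ (leq_maxr n n') _ lt.
rewrite -[(_ - y') k]/(_ - y' k) -[(_ - y) k]/(_ - y k).
by move=> /eqP; rewrite subr_eq0 => /eqP-> /eqP; rewrite subr_eq0 => /eqP.
Qed.

(* The finite continued fraction [1/(a_0 + 1/(a_1 + ... + 1/a_n))] *)
Fixpoint CFn (a : nat -> {poly K}) (n : nat) : {fraction {poly K}} :=
  if n is m.+1 then ((a 0%N)%:F + CFn (fun j => a j.+1) m)^-1
  else ((a 0%N)%:F)^-1.

(* By [CF_cvg] and [laurent_cvg_unique], this is the limit of the [CFn a n]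
   as soon as no [a j] is constant. *)
Definition CF (a : nat -> {poly K}) : laurent K :=
  xget 0 [set y | laurent_cvg (fun n => frac_laurent (CFn a n)) y]%classic.

Lemma deg_leV (d : int) f : deg_le d f -> f d != 0 -> deg_le (- d) f^-1.
Proof.
move=> fd nz.
have f0 : f != 0 by apply: contraNneq nz => ->.
have [e ge nz'] : exists2 e, deg_le e f^-1 & f^-1 e != 0.
  by apply: laurent_deg; rewrite invr_eq0.
suff /eqP de : d + e == 0 by rewrite (_ : - d = e) //; lia.
apply: contraNT (mulf_neq0 nz nz') => de.
have := lmulE 0 fd ge; rewrite -[lmul _ _]/(f * f^-1) mulfV // big_ord1 !subr0.
by move=> <-; rewrite -[(1 : laurent K) _]/((d + e == 0)%:R : K) (negbTE de).
Qed.

Lemma deg_leB d f g : deg_le d f -> deg_le d g -> deg_le d (f - g).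
Proof. by move=> fd gd k lt; rewrite -[LHS]/(f k - g k) fd // gd // subr0. Qed.

Lemma deg_leN d f : deg_le d f -> deg_le d (- f).
Proof. by move=> fd k lt; rewrite -[LHS]/(- f k) fd // oppr0. Qed.

Lemma CFstep (p : {poly K}) y : (1 < size p)%N -> deg_le (-1) y ->
  poly_laurent p + y != 0 /\ deg_le (-1) (poly_laurent p + y)^-1.
Proof.
move=> p1 y1; pose d := ((size p).-1)%:Z.
have pd : deg_le d (poly_laurent p) by apply: poly_laurent_deg; lia.
have yd : deg_le d y by apply: deg_leW y1; rewrite /d; lia.
have nz : (poly_laurent p + y) d != 0.
  rewrite -[_ d]/(p`_((size p).-1) + y d) y1 ?addr0; last by rewrite /d; lia.
  by rewrite -lead_coefE lead_coef_eq0 -size_poly_eq0; lia.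
split; first by apply: contraNneq nz => ->.
by apply: deg_leW (deg_leV (ladd_deg pd yd) nz); rewrite /d; lia.
Qed.

Lemma frac_CFnS a n : frac_laurent (CFn a n.+1) =
  (poly_laurent (a 0%N) + frac_laurent (CFn (fun j => a j.+1) n))^-1.
Proof. by rewrite /= fmorphV rmorphD /= frac_laurent_poly. Qed.

Lemma CFn_deg a n : (forall j, 1 < size (a j))%N ->
  deg_le (-1) (frac_laurent (CFn a n)).
Proof.
elim: n a => [|n IH] a a1.
  rewrite /= fmorphV /= frac_laurent_poly -[poly_laurent _]addr0.
  by have [] := @CFstep _ 0 (a1 0%N).
by rewrite frac_CFnS; have [] := CFstep (a1 0%N) (IH _ (fun j => a1 j.+1)).
Qed.

Lemma CFn_cauchy a n m : (forall j, 1 < size (a j))%N -> (n <= m)%N ->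
  deg_le (- n%:Z) (frac_laurent (CFn a m) - frac_laurent (CFn a n)).
Proof.
elim: n m a => [|n IH] [|m] a a1 // le.
- by rewrite subrr.
- by apply: deg_leW (deg_leB (CFn_deg _ a1) (CFn_deg _ a1)).
have a1' j : (1 < size (a j.+1))%N by [].
rewrite !frac_CFnS.
have [nzm dm] := CFstep (a1 0%N) (CFn_deg m a1').
have [nzn dn] := CFstep (a1 0%N) (CFn_deg n a1').
have := IH m _ a1' le; move: nzm dm nzn dn.
set p := poly_laurent _; set ym := frac_laurent _; set yn := frac_laurent _.
move=> nzm dm nzn dn d.
rewrite (_ : _ - _ = - ((p + ym)^-1 * (p + yn)^-1 * (ym - yn))); last first.
  apply: (mulfI nzm); apply: (mulfI nzn); rewrite mulrBr mulfV // mulrBr mulr1.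
  rewrite mulrCA mulfV // mulr1 !mulrN mulrA [_ * (p + ym)]mulrC -invfM mulrA.
  by rewrite mulfV ?mulf_neq0 // mul1r opprB opprD addrACA subrr add0r.
apply: (@deg_leW _ (-1 - 1 - n%:Z)); first by lia.
by apply: deg_leN; apply: lmul_deg d; apply: lmul_deg.
Qed.

Lemma CF_cvg a : (forall j, 1 < size (a j))%N ->
  laurent_cvg (fun n => frac_laurent (CFn a n)) (CF a).
Proof.
move=> a1; apply: (@xgetPex _ 0
  [set y | laurent_cvg (fun n => frac_laurent (CFn a n)) y]%classic).
pose x n := frac_laurent (CFn a n).
have yd : exists N, forall k : int, N < k -> x `|k|.+1 k = 0.
  by exists (-1) => k lt; rewrite CFn_deg.
exists (Laurent yd) => N; exists `|N|.+1 => n le k lt.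
rewrite -[LHS]/(x n k - x `|k|.+1 k).
have [k0|k0] := leP 0 k; first by rewrite /x !CFn_deg ?subrr //; lia.
rewrite -[LHS]/((x n - x `|k|.+1) k); apply: CFn_cauchy => //; lia.
Qed.

(* An irreducible annihilating polynomial over [K(z)], not necessarily monic *)
Definition is_minimal_polynomial (P : {poly {fraction {poly K}}}) (y : laurent K)
  : Prop :=
  irreducible_poly P /\ root (map_poly (@frac_laurent K) P) y.

Definition quartic (p0 p1 p2 p3 p4 : {poly K}) : {poly {fraction {poly K}}} :=
  p4%:F *: 'X^4 + p3%:F *: 'X^3 + p2%:F *: 'X^2 + p1%:F *: 'X + p0%:F%:P.

End ContinuedFraction.

(** * The Thue-Morse sequence *)

Section ThueMorse.
Variable A : eqType.
Implicit Types (a b x : A) (w : seq A).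

(* [a |-> ab, b |-> ba]; the value at letters other than [a] and [b] is
   irrelevant *)
Definition tm_subst (a b x : A) : seq A :=
  if x == a then [:: a; b] else [:: b; a].

Definition tm_subst_word (a b : A) (w : seq A) : seq A :=
  flatten [seq tm_subst a b x | x <- w].

(* The words [s^n(a)], of length [2 ^ n], are prefixes of one another; their limit
   is read off at index [j] on [s^j(a)], since [j < 2 ^ j]. *)
Definition thue_morse (a b : A) (j : nat) : A :=
  nth a (iter j (tm_subst_word a b) [:: a]) j.

Lemma size_tm_iter a b n : size (iter n (tm_subst_word a b) [:: a]) = (2 ^ n)%N.
Proof.
have sz w : size (tm_subst_word a b w) = (2 * size w)%N.
  by elim: w => //= x w IH; rewrite size_cat IH /tm_subst; case: ifP => _ /=; lia.
by elim: n => //= n IH; rewrite sz IH expnS.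
Qed.

Lemma tm_iter_prefix a b n :
  prefix (iter n (tm_subst_word a b) [:: a]) (iter n.+1 (tm_subst_word a b) [:: a]).
Proof.
elim: n => [|n /prefixP[w IH]].
  by rewrite /= /tm_subst_word /= /tm_subst eqxx /= eqxx.
rewrite [X in prefix X _]iterS [X in prefix _ X]iterS IH /tm_subst_word.
rewrite map_cat flatten_cat.
exact: prefix_prefix.
Qed.

Lemma thue_morse_iter a b n j : (j < 2 ^ n)%N ->
  nth a (iter n (tm_subst_word a b) [:: a]) j = thue_morse a b j.
Proof.
have step m : (j < 2 ^ m)%N ->
    nth a (iter m.+1 (tm_subst_word a b) [:: a]) j
    = nth a (iter m (tm_subst_word a b) [:: a]) j.
  move=> lt; have /prefixP[w ->] := tm_iter_prefix a b m.
  by rewrite nth_cat size_tm_iter lt.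
have up m d : (j < 2 ^ m)%N ->
    nth a (iter (d + m) (tm_subst_word a b) [:: a]) j
    = nth a (iter m (tm_subst_word a b) [:: a]) j.
  move=> lt; elim: d => // d IH; rewrite addSn step ?IH //.
  by apply: leq_trans lt _; rewrite leq_exp2l // leq_addl.
move=> lt; rewrite /thue_morse.
have [le|/ltnW le] := leqP j n; first by rewrite -(subnK le) up // ltn_expl.
by rewrite -{2}(subnK le) up.
Qed.

Lemma thue_morse0 a b : thue_morse a b 0 = a.
Proof. by []. Qed.

Lemma thue_morse_fixed a b j :
  [:: thue_morse a b (2 * j); thue_morse a b (2 * j).+1]
  = tm_subst a b (thue_morse a b j).
Proof.
have lt : (j < 2 ^ j)%N by rewrite ltn_expl.
have [lt0 lt1] : (2 * j < 2 ^ j.+1)%N /\ ((2 * j).+1 < 2 ^ j.+1)%N.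
  by rewrite expnS; lia.
rewrite -(thue_morse_iter a b lt0) -(thue_morse_iter a b lt1) iterS /thue_morse.
move: {lt0 lt1}(iter j _ _) (size_tm_iter a b j) => w sw; rewrite -{}sw in lt.
elim: w j lt => //= x w IH [_|j lt].
  by rewrite muln0 /tm_subst_word /= /tm_subst; case: ifP.
rewrite -(IH j lt) mulnS !addSn add0n /tm_subst_word /= /tm_subst.
by case: ifP.
Qed.

End ThueMorse.

(* Main.v *)
Require Import Defs.
From HB Require Import structures.
From mathcomp Require Import all_boot all_order all_algebra.
From mathcomp Require Import ring zify.

Set Implicit Arguments.
Unset Strict Implicit.
Unset Printing Implicit Defensive.

Import GRing.Theory.
Local Open Scope ring_scope.

(** Write [A_c] for the matrix with rows [(c, 1)] and [(1, 0)], and let [M_n]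
    and [N_n] be the products of the [A_c] along the words [s^n(a)] and
    [s^n(b)].  The first column of [M_n] holds the denominator and the numerator
    of the convergent of [CF t] that stops after [2 ^ n] partial quotients.  In
    characteristic 2 all these matrices have determinant 1, and Cayley-Hamilton
    turns [M_{n+2} = M_n N_n N_n M_n] into a combination of [M_n], [N_n] and the
    identity with coefficients in the traces.

    Put [S = a b], [E = a + b], [Q = S + E] and [sigma = S / Q].  At even levels
    [n >= 2] the words are palindromes, so [M_n] has rows [(x, p)] and
    [(p, x + t)] with [t] its trace; moreover [N_n] is [M_n] plus [t] times a
    fixed matrix depending on [sigma] only.  The passage from [n] to [n + 2] is
    then the explicit map of [palindrome_step], which sends [t] to
    [sigma ^ 2 t ^ 4].

    At these levels [p / t] is a constant plus [(1 + sigma) g] and [(x + p) / t]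
    is a constant plus [g + g ^ 2], for the same element [g] depending on [n]:
    the increments of [p / t] are a fixed multiple of [1 / t_{n+1}], those of
    [(x + p) / t] are combinations of [1 / t_{n+1}] and [1 / t_{n+2}], and
    [t_{n+2}] is a fixed multiple of [t_{n+1} ^ 2].  Eliminating [g] leaves a
    relation between [x], [p] and [t] that holds at every even level
    ([tm_invariant]).  Together with [det M_n = 1] it gives a quartic form in the
    convergent [y = p / x] whose value is [x ^ -2] times a bounded factor
    ([tm_quartic_convergent]).  As the denominators [x] have unbounded degree,
    the limit of the convergents is a root of the quartic
    ([tm_quartic_CF], [root_quartic_CF]).  This holds for all nonconstant
    [a <> b] over any field of characteristic 2; exchanging [a] and [b] gives
    the second series.

    For [a = z] and [b = z ^ 2 + z + 1] both quartics are irreducible by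
    Eisenstein's criterion at the prime [z] of [F_2[z]]: directly for the second
    one, and for the first one after reversing the order of its coefficients
    ([eisenstein], [eisenstein_rev]). *)

(** * Computing in characteristic 2 *)

Lemma natr_char2 (R : pzRingType) (h : 2%:R = 0 :> R) n : n%:R = (odd n)%:R :> R.
Proof. by rewrite -[in LHS](odd_double_half n) natrD -muln2 natrM h mulr0 addr0. Qed.

(** [ring] rewrites an integer coefficient only when it equals the left-hand side
    of a supplied equation, so that [2 = 0] alone does not reduce the coefficient
    3; hence one equation for each of the coefficients met in the expansions
    below.  [eqn] is a further equation to reduce by. *)
Ltac ring_char2_mod eqn h :=
  ring: eqn
    (natr_char2 h 2 : 2%:R = 0) (natr_char2 h 3 : 3%:R = 1)
    (natr_char2 h 4 : 4%:R = 0) (natr_char2 h 5 : 5%:R = 1)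
    (natr_char2 h 6 : 6%:R = 0) (natr_char2 h 7 : 7%:R = 1)
    (natr_char2 h 8 : 8%:R = 0) (natr_char2 h 9 : 9%:R = 1)
    (natr_char2 h 10 : 10%:R = 0) (natr_char2 h 11 : 11%:R = 1)
    (natr_char2 h 12 : 12%:R = 0) (natr_char2 h 13 : 13%:R = 1)
    (natr_char2 h 14 : 14%:R = 0) (natr_char2 h 15 : 15%:R = 1)
    (natr_char2 h 16 : 16%:R = 0) (natr_char2 h 17 : 17%:R = 1)
    (natr_char2 h 18 : 18%:R = 0) (natr_char2 h 19 : 19%:R = 1)
    (natr_char2 h 20 : 20%:R = 0) (natr_char2 h 21 : 21%:R = 1)
    (natr_char2 h 22 : 22%:R = 0) (natr_char2 h 23 : 23%:R = 1)
    (natr_char2 h 24 : 24%:R = 0) (natr_char2 h 25 : 25%:R = 1)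
    (natr_char2 h 26 : 26%:R = 0) (natr_char2 h 27 : 27%:R = 1)
    (natr_char2 h 28 : 28%:R = 0) (natr_char2 h 29 : 29%:R = 1)
    (natr_char2 h 30 : 30%:R = 0) (natr_char2 h 31 : 31%:R = 1)
    (natr_char2 h 32 : 32%:R = 0) (natr_char2 h 33 : 33%:R = 1)
    (natr_char2 h 34 : 34%:R = 0) (natr_char2 h 35 : 35%:R = 1)
    (natr_char2 h 36 : 36%:R = 0) (natr_char2 h 37 : 37%:R = 1)
    (natr_char2 h 38 : 38%:R = 0) (natr_char2 h 39 : 39%:R = 1)
    (natr_char2 h 40 : 40%:R = 0).

Ltac ring_char2 h := ring_char2_mod (natr_char2 h 2 : 2%:R = 0) h.

(** * Continuant matrices and convergents *)

Definition mx2 (R : Type) (x y z w : R) : 'M[R]_2 :=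
  \matrix_(i, j) (if i == 0 then if j == 0 then x else y
                  else if j == 0 then z else w).

Lemma mx2M (R : comNzRingType) (x y z w x' y' z' w' : R) :
  mx2 x y z w * mx2 x' y' z' w' =
  mx2 (x * x' + y * z') (x * y' + y * w') (z * x' + w * z') (z * y' + w * w').
Proof.
apply/matrixP => i j; rewrite !mxE !big_ord_recl big_ord0 !mxE addr0 /=.
by case: eqP => _; case: eqP => _.
Qed.

Definition continuant (R : comNzRingType) (s : seq R) : 'M[R]_2 :=
  \prod_(c <- s) mx2 c 1 1 0.

Lemma continuant_cat (R : comNzRingType) (u v : seq R) :
  continuant (u ++ v) = continuant u * continuant v.
Proof. exact: big_cat. Qed.

Section Convergents.
Variable K : fieldType.
Implicit Types (a : nat -> {poly K}) (n : nat).
Local Notation emb := (@poly_laurent K).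

(** The degree bound holds because the inverse denominator is the product of the
    [n + 1] tails [(a_j + 1 / (a_{j+1} + ...))^-1] of the finite continued
    fraction, each of degree at most [-1]. *)
Lemma CFn_continuant a n : (forall j, 1 < size (a j))%N ->
  let M := continuant (mkseq (fun j => emb (a j)) n.+1) in
  [/\ M 0 0 != 0, deg_le (- n.+1%:Z) (M 0 0)^-1 &
      frac_laurent (CFn a n) = M 1 0 / M 0 0].
Proof.
elim: n a => [|n IH] a a1 M.
  have -> : M = mx2 (emb (a 0%N)) 1 1 0 by rewrite /M /continuant big_seq1.
  have [nz d] := @CFstep K (a 0%N) 0 (a1 0%N) (fun _ _ => erefl).
  rewrite !mxE /= fmorphV /= frac_laurent_poly mul1r.
  by rewrite addr0 in nz d; split.
have [] := IH (fun j => a j.+1) (fun j => a1 j.+1).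
set M' := continuant _ => nz d eq.
have -> : M = mx2 (emb (a 0%N)) 1 1 0 * M'.
  rewrite -[RHS](big_cons _ _ (emb (a 0%N)) _ predT) /M /continuant.
  congr (bigop.body _ _ _); rewrite /mkseq.
  by rewrite -[iota _ _]/(0%N :: iota (1 + 0) n.+1) iotaDl /= -map_comp.
have E0 : (mx2 (emb (a 0%N)) 1 1 0 * M') 0 0
    = M' 0 0 * (emb (a 0%N) + M' 1 0 / M' 0 0).
  rewrite mxE !big_ord_recl big_ord0 !mxE /= mulrDr mulrCA divff // addr0 mulr1.
  rewrite mul1r mulrC.
  by congr (_ + M' _ _); apply: val_inj.
have E1 : (mx2 (emb (a 0%N)) 1 1 0 * M') 1 0 = M' 0 0.
  by rewrite mxE !big_ord_recl big_ord0 !mxE /= mul0r mul1r !addr0.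
have [nz' d'] := CFstep (a1 0%N) (CFn_deg n (fun j => a1 j.+1)).
rewrite eq in nz' d'; rewrite E0 E1; split; first by rewrite mulf_neq0.
  by rewrite invfM (_ : - n.+2%:Z = - n.+1%:Z + (-1)); [exact: lmul_deg | lia].
by rewrite frac_CFnS eq invfM mulrA divff // mul1r.
Qed.

End Convergents.

(** * Limits of Laurent series *)

Section Limits.
Variable K : fieldType.
Implicit Types (f g : laurent K) (u v : nat -> laurent K).

Lemma laurent_cvg_cst f : laurent_cvg (fun=> f) f.
Proof. by move=> N; exists 0%N => n _; rewrite subrr. Qed.

Lemma laurent_cvgD u v f g : laurent_cvg u f -> laurent_cvg v g ->
  laurent_cvg (fun n => u n + v n) (f + g).
Proof.
move=> uf vg N; have [n1 H1] := uf N; have [n2 H2] := vg N.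
exists (maxn n1 n2) => n; rewrite geq_max => /andP[/H1 d1 /H2 d2].
by rewrite opprD addrACA; exact: ladd_deg.
Qed.

Lemma laurent_cvgM u v f g : laurent_cvg u f -> laurent_cvg v g ->
  laurent_cvg (fun n => u n * v n) (f * g).
Proof.
move=> uf vg N; have [A fA] := deg_le_ex f; have [B gB] := deg_le_ex g.
have [n1 H1] := uf (N - B); have [n2 H2] := vg (N - A).
have [n3 H3] := uf A.
exists (maxn n1 (maxn n2 n3)) => n; rewrite !geq_max => /and3P[/H1 d1 /H2 d2 /H3 d3].
have unA : deg_le A (u n) by rewrite -(subrK f (u n)); exact: ladd_deg.
have -> : u n * v n - f * g = u n * (v n - g) + (u n - f) * g by ring.
apply: ladd_deg; last by rewrite -(subrK B N); exact: lmul_deg.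
by rewrite -(subrKC A N); exact: lmul_deg.
Qed.

Lemma laurent_cvg_sub u f (phi : nat -> nat) : (forall n, n <= phi n)%N ->
  laurent_cvg u f -> laurent_cvg (u \o phi) f.
Proof.
move=> le uf N; have [n0 H] := uf N; exists n0 => n n0n.
by apply: H; apply: leq_trans (le n).
Qed.

Lemma laurent_cvgX u f m : laurent_cvg u f ->
  laurent_cvg (fun n => u n ^+ m) (f ^+ m).
Proof.
move=> uf; elim: m => [|m IH]; first exact: laurent_cvg_cst.
rewrite (_ : (fun n => _) = (fun n => u n * u n ^+ m)).
  by rewrite exprS; exact: laurent_cvgM.
by apply: boolp.funext => n; rewrite exprS.
Qed.

End Limits.

(** * Thue-Morse words *)

Section Words.
Variables (A : eqType) (a b : A).
Local Notation word n c := (iter n (tm_subst_word a b) [:: c]).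

Lemma iter_tm_subst_cat n (u v : seq A) :
  iter n (tm_subst_word a b) (u ++ v) =
  iter n (tm_subst_word a b) u ++ iter n (tm_subst_word a b) v.
Proof.
elim: n u v => // n IH u v.
by rewrite !iterSr /tm_subst_word map_cat flatten_cat IH.
Qed.

Lemma tm_wordSa n : word n.+1 a = word n a ++ word n b.
Proof.
rewrite iterSr {2}/tm_subst_word /= /tm_subst eqxx /=.
exact: (iter_tm_subst_cat _ [:: a]).
Qed.

Lemma tm_wordSb n : a != b -> word n.+1 b = word n b ++ word n a.
Proof.
move=> ab; rewrite iterSr {2}/tm_subst_word /= /tm_subst eq_sym (negbTE ab) /=.
exact: (iter_tm_subst_cat _ [:: b]).
Qed.

Lemma thue_morse_letter n : thue_morse a b n \in [:: a; b].
Proof.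
have /(all_nthP a) : all (mem [:: a; b]) (word n a).
  elim: n => [|n IH]; first by rewrite /= inE eqxx.
  rewrite iterS; apply/allP => y /flatten_mapP[x _].
  by rewrite /tm_subst; case: ifP => _; rewrite /= !inE // orbC.
by apply; rewrite size_tm_iter ltn_expl.
Qed.

End Words.

(** * The recurrence on even levels *)

Section QuarticForm.
Variable R : comNzRingType.
Implicit Types a b y : R.

(** The coefficient of [t ^ 2] in the relation that remains after the elimination
    of [g]; [p2] and [(a * b + 1) ^+ 2 + a ^+ 2] are the off-diagonal and the upper
    left entries of [A_a A_b A_b A_a], the initial values of [p] and [x]. *)
Definition tm_coef a b :=
  let E := a + b in let S := a * b in let p2 := (a * b + 1) * b + a in
  p2 ^+ 2 + E * S * p2 + E ^+ 2 * ((a * b + 1) ^+ 2 + a ^+ 2).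

Definition tm_quartic a b y :=
  let E := a + b in let S := a * b in let Q := S + E in
  tm_coef a b * y ^+ 4 + E * S * Q ^+ 2 * y ^+ 3 + S ^+ 2 * Q ^+ 2 * y ^+ 2
  + E * S * Q ^+ 2 * y + (tm_coef a b + E ^+ 2 * Q ^+ 2).

End QuarticForm.

Section Palindromic.
Variables (F : fieldType) (two0 : 2%:R = 0 :> F).
Implicit Types x p t sg : F.

Definition sym_mx x p t : 'M[F]_2 := mx2 x p p (x + t).

(** [N = M + t (c J + d I)], where [J] exchanges the two coordinates.  As
    [c ^ 2 = d ^ 2 + d], both matrices have the same trace and the same
    determinant, so that the shape of the pair survives the passage to
    [M N N M] and [N M M N]. *)
Lemma palindrome_step sg x p t :
  p ^+ 2 = 1 + x ^+ 2 + x * t ->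
  let d := 1 + sg ^+ 2 in let c := sg + sg ^+ 2 in
  let x' := sg ^+ 2 * t ^+ 3 * x + sg ^+ 2 * t ^+ 2 + 1 in
  let p' := sg ^+ 2 * t ^+ 3 * p + c * t ^+ 2 in
  let t' := sg ^+ 2 * t ^+ 4 in
  let M := sym_mx x p t in let N := sym_mx (x + d * t) (p + c * t) t in
  [/\ p' ^+ 2 = 1 + x' ^+ 2 + x' * t',
      M * N * N * M = sym_mx x' p' t' &
      N * M * M * N = sym_mx (x' + d * t') (p' + c * t') t'].
Proof.
move=> det d c x' p' t' M N.
rewrite /M /N /x' /p' /t' /c /d {M N x' p' t' c d} /sym_mx !mx2M; split.
- by ring_char2_mod det two0.
- by congr mx2; ring_char2_mod det two0.
- by congr mx2; ring_char2_mod det two0.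
Qed.

Variables a b : F.
Local Notation S := (a * b).
Local Notation E := (a + b).
Local Notation Q := (a * b + (a + b)).
Local Notation x2 := ((a * b + 1) ^+ 2 + a ^+ 2).
Local Notation p2 := ((a * b + 1) * b + a).

(** The first equation is [det = 1].  The second one is the result of eliminating
    [g] between [p / t = p2 / Q ^ 2 + (1 + sigma) g] and
    [(x + p) / t = (x2 + p2) / Q ^ 2 + g + g ^ 2]. *)
Definition tm_invariant x p t := [/\ p ^+ 2 = 1 + x ^+ 2 + x * t &
  tm_coef a b * t ^+ 2 + E * S * Q ^+ 2 * t * p + E ^+ 2 * Q ^+ 2 * t * x
  + Q ^+ 4 * p ^+ 2 = 0].

(** The quartic form [x ^ 4 tm_quartic (p / x)] has degree 4 in [x] and [p], but by
    [(x + p) ^ 2 = x t + 1] it differs from [x ^ 2] times the second equation of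
    the invariant by terms of degree at most 2 only. *)
Lemma tm_quartic_convergent x p t : x != 0 -> tm_invariant x p t ->
  tm_quartic a b (p / x) = x^-1 ^+ 2 *
    (tm_coef a b * x^-1 ^+ 2 + E * S * Q ^+ 2 * (1 + p / x) + E * Q ^+ 3).
Proof.
move=> x0 [det inv]; rewrite /tm_quartic; move: (tm_coef a b) inv => C inv.
apply: (mulIf (expf_neq0 4 x0)).
rewrite [LHS](_ : _ = C * p ^+ 4 + E * S * Q ^+ 2 * p ^+ 3 * x
  + S ^+ 2 * Q ^+ 2 * p ^+ 2 * x ^+ 2 + E * S * Q ^+ 2 * p * x ^+ 3
  + (C + E ^+ 2 * Q ^+ 2) * x ^+ 4); last by field.
rewrite [RHS](_ : _ = C + E * S * Q ^+ 2 * (x + p) * x + E * Q ^+ 3 * x ^+ 2);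
  last by field.
rewrite -[RHS]addr0 -(mulr0 (x ^+ 2)) -inv {inv}.
(* S and E become indeterminates, which keeps the coefficients small *)
by move: (S) (E) => u v; ring_char2_mod det two0.
Qed.

Hypothesis Q0 : Q != 0.
Local Notation sg := (S / Q).
Local Notation d := (1 + sg ^+ 2).
Local Notation c := (sg + sg ^+ 2).

Lemma tm_invariant_step x p t : tm_invariant x p t -> tm_invariant
  (sg ^+ 2 * t ^+ 3 * x + sg ^+ 2 * t ^+ 2 + 1)
  (sg ^+ 2 * t ^+ 3 * p + c * t ^+ 2) (sg ^+ 2 * t ^+ 4).
Proof.
move=> [det inv]; have [det' _ _] := palindrome_step sg det; split=> //.
rewrite -[RHS](mulr0 ((sg ^+ 2 * t ^+ 3) ^+ 2)) -inv; move: (tm_coef a b) => C.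
have eqS : S = sg * Q by rewrite divfK.
have eqE : E = (sg + 1) * Q by rewrite mulrDl -eqS; ring_char2 two0.
by move: (S) (E) (Q) (sg) eqS eqE => S0 E0 v u -> ->; ring_char2 two0.
Qed.

Lemma tm_invariant_base : [/\ tm_invariant x2 p2 (Q ^+ 2),
  mx2 a 1 1 0 * mx2 b 1 1 0 * mx2 b 1 1 0 * mx2 a 1 1 0 = sym_mx x2 p2 (Q ^+ 2) &
  mx2 b 1 1 0 * mx2 a 1 1 0 * mx2 a 1 1 0 * mx2 b 1 1 0 =
    sym_mx (x2 + d * Q ^+ 2) (p2 + c * Q ^+ 2) (Q ^+ 2)].
Proof.
have -> : d * Q ^+ 2 = Q ^+ 2 + S ^+ 2 by field.
have -> : c * Q ^+ 2 = S * Q + S ^+ 2 by field.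
rewrite /sym_mx !mx2M; split.
- split; first by ring_char2 two0.
  by rewrite /tm_coef; move: (p2) (x2) (Q) (S) (E) => *; ring_char2 two0.
- by congr mx2; ring_char2 two0.
- by congr mx2; ring_char2 two0.
Qed.

End Palindromic.

(** * The quartic equation *)

Lemma root_quarticE (K : fieldType) (p0 p1 p2 p3 p4 : {poly K}) (y : laurent K) :
  root (map_poly (@frac_laurent K) (quartic p0 p1 p2 p3 p4)) y =
  (poly_laurent p4 * y ^+ 4 + poly_laurent p3 * y ^+ 3 + poly_laurent p2 * y ^+ 2
    + poly_laurent p1 * y + poly_laurent p0 == 0).
Proof.
rewrite rootE /quartic.
do 4!rewrite [map_poly _ (_ + _)]rmorphD [in LHS]hornerD /=.
rewrite !map_polyZ !map_polyXn map_polyX map_polyC /=.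
by rewrite !hornerZ !hornerXn hornerX hornerC !frac_laurent_poly.
Qed.

Section Root.
Variables (K : fieldType) (two0 : 2%:R = 0 :> K) (a b : {poly K}).
Hypotheses (ab : a != b) (a1 : (1 < size a)%N) (b1 : (1 < size b)%N).
Local Notation emb := (@poly_laurent K).
Local Notation word n c := (iter n (tm_subst_word a b) [:: c]).
Local Notation word_mx n c := (continuant (map emb (word n c))).

Lemma word_mxSa n : word_mx n.+1 a = word_mx n a * word_mx n b.
Proof. by rewrite tm_wordSa map_cat continuant_cat. Qed.

Lemma word_mxSb n : word_mx n.+1 b = word_mx n b * word_mx n a.
Proof. by rewrite tm_wordSb // map_cat continuant_cat. Qed.

Lemma laurent_two0 : 2%:R = 0 :> laurent K.
Proof. by rewrite -(rmorph_nat emb) -(rmorph_nat (@polyC K)) two0 !rmorph0. Qed.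

(** Both letters have positive degree, so [a * b] has larger degree than
    [a + b]; this makes [sigma] a genuine fraction. *)
Lemma mul_add_neq0 : a * b + (a + b) != 0.
Proof.
have a0 : a != 0 by rewrite -size_poly_gt0 ltnW.
have b0 : b != 0 by rewrite -size_poly_gt0 ltnW.
rewrite addr_eq0; apply/negP => /eqP eq.
have := size_mul a0 b0; rewrite eq size_polyN.
have := size_polyD a b; rewrite leq_max; move: (size (a + b)) => w.
by case/orP=> le eqw; move: le a1 b1; rewrite eqw; move: (size a) (size b); lia.
Qed.

(** The induction starts at level 2 because [A_a] and [A_b], the matrices of level
    0, have different traces. *)
Lemma word_mx_even k : let A := emb a in let B := emb b in
  let sg := A * B / (A * B + (A + B)) in
  exists x p t, [/\ tm_invariant A B x p t,
    word_mx (2 * k + 2) a = sym_mx x p t &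
    word_mx (2 * k + 2) b =
      sym_mx (x + (1 + sg ^+ 2) * t) (p + (sg + sg ^+ 2) * t) t].
Proof.
move=> A B sg.
have q0 : A * B + (A + B) != 0.
  by rewrite -!(rmorphM, rmorphD) poly_laurent_eq0 mul_add_neq0.
elim: k => [|k [x [p [t [inv Ma Mb]]]]].
  have [inv Ma Mb] := tm_invariant_base laurent_two0 q0.
  exists ((A * B + 1) ^+ 2 + A ^+ 2), ((A * B + 1) * B + A), ((A * B + (A + B)) ^+ 2).
  split=> //; rewrite (word_mxSa 1, word_mxSb 1) (word_mxSa 0) (word_mxSb 0) /=.
    by rewrite /continuant !big_seq1 mulrA Ma.
  by rewrite /continuant !big_seq1 mulrA Mb.
rewrite mulnS -addnA addSn add1n.
rewrite !(word_mxSa, word_mxSb) Ma Mb !mulrA.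
have [det _] := inv; have [_ Ma' Mb'] := palindrome_step laurent_two0 sg det.
eexists _, _, _; split; first exact: (tm_invariant_step laurent_two0 q0 inv).
  by rewrite Ma'.
by rewrite Mb'.
Qed.

Lemma thue_morse_size n : (1 < size (thue_morse a b n))%N.
Proof. by have := thue_morse_letter a b n; rewrite !inE => /orP[] /eqP->. Qed.

Lemma mkseq_thue_morse n :
  mkseq (fun j => emb (thue_morse a b j)) (2 ^ n) = map emb (word n a).
Proof.
apply: (@eq_from_nth _ 0); rewrite size_mkseq ?size_map ?size_tm_iter // => i lt.
by rewrite nth_mkseq // (nth_map a) ?size_tm_iter // thue_morse_iter.
Qed.

(** Only the convergents [u k] that end with the word of an even level are used;
    [h k] is the inverse of the denominator of [u k]. *)
Theorem tm_quartic_CF :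
  tm_quartic (emb a) (emb b) (CF (thue_morse a b)) = 0.
Proof.
set A := emb a; set B := emb b; set y := CF _.
pose phi k := (2 ^ (2 * k + 2)).-1.
have phiS k : (phi k).+1 = (2 ^ (2 * k + 2))%N by rewrite prednK ?expn_gt0.
have le_phi k : (k <= phi k)%N.
  by rewrite -ltnS phiS; apply: (leq_trans _ (ltnW (ltn_expl _ _))) => //; lia.
pose u k := frac_laurent (CFn (thue_morse a b) (phi k)).
have uy : laurent_cvg u y := laurent_cvg_sub le_phi (CF_cvg thue_morse_size).
pose h k := (word_mx (2 * k + 2) a 0 0)^-1.
have h0 : laurent_cvg h 0.
  move=> N; exists `|N|%N => k le; rewrite subr0.
  have [_ dk _] := CFn_continuant (phi k) thue_morse_size.
  move: dk; rewrite phiS mkseq_thue_morse; apply: deg_leW.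
  have := le_phi k; rewrite -ltnS phiS; move: (2 ^ _)%N le; clear=> m.
  by lia.
have eq k : tm_quartic A B (u k) = h k ^+ 2 * (tm_coef A B * h k ^+ 2
    + (A + B) * (A * B) * (A * B + (A + B)) ^+ 2 * (1 + u k)
    + (A + B) * (A * B + (A + B)) ^+ 3).
  have [nz _ eqCF] := CFn_continuant (phi k) thue_morse_size.
  rewrite /u /h eqCF; move: nz; rewrite phiS mkseq_thue_morse.
  have [x [p [t [inv -> _]]]] := word_mx_even k.
  by rewrite !mxE /= => nz; exact: (tm_quartic_convergent laurent_two0 nz inv).
have hX2 : laurent_cvg (fun k => h k ^+ 2) 0.
  by have := laurent_cvgX 2 h0; rewrite expr0n.
have uX m : laurent_cvg (fun k => u k ^+ m) (y ^+ m) by exact: laurent_cvgX.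
(* both sides of [eq] converge, the right one to 0 *)
apply: (@laurent_cvg_unique _ (fun k => tm_quartic A B (u k))).
  rewrite /tm_quartic; do 4?[apply: laurent_cvgD; last
    by [apply: laurent_cvgM => //; exact: laurent_cvg_cst | exact: laurent_cvg_cst]].
  by apply: laurent_cvgM => //; exact: laurent_cvg_cst.
rewrite (boolp.funext eq) -[X in laurent_cvg _ X](mul0r
  (tm_coef A B * 0 + (A + B) * (A * B) * (A * B + (A + B)) ^+ 2 * (1 + y)
    + (A + B) * (A * B + (A + B)) ^+ 3)).
apply: laurent_cvgM => //; apply: laurent_cvgD; last exact: laurent_cvg_cst.
apply: laurent_cvgD; apply: laurent_cvgM => //; try exact: laurent_cvg_cst.
by apply: laurent_cvgD => //; exact: laurent_cvg_cst.
Qed.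

Local Notation S := (a * b).
Local Notation E := (a + b).
Local Notation Q := (a * b + (a + b)).
Local Notation C := (tm_coef a b).

Theorem root_quartic_CF :
  root (map_poly (@frac_laurent K)
    (quartic (C + E ^+ 2 * Q ^+ 2) (E * S * Q ^+ 2) (S ^+ 2 * Q ^+ 2)
       (E * S * Q ^+ 2) C))
    (CF (thue_morse a b)).
Proof.
rewrite root_quarticE -[X in _ == X]tm_quartic_CF; apply/eqP.
by rewrite /tm_quartic /tm_coef !(rmorphD, rmorphM, rmorphXn, rmorph1).
Qed.

End Root.

(** * Eisenstein's criterion over [K(z)] *)

Lemma irreducible_no_factor (F : fieldType) (p : {poly F}) : (1 < size p)%N ->
  (forall q r, p = q * r -> (1 < size q)%N -> (1 < size r)%N -> False) ->
  irreducible_poly p.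
Proof.
move=> p1 no; split=> // q q1 /dvdpP[r pE].
have p0 : p != 0 by rewrite -size_poly_gt0 ltnW.
have : r * q != 0 by rewrite -pE.
rewrite mulf_eq0 negb_or => /andP[r0 q0].
rewrite -dvdp_size_eqp; last by rewrite pE dvdp_mull.
have szp : size p = (size r + size q).-1 by rewrite pE size_mul.
have := no r q pE; rewrite -size_poly_gt0 in r0; rewrite -size_poly_gt0 in q0.
by move: (size p) (size q) (size r) q1 szp r0 q0 {p1}; lia.
Qed.

Section Reduction.
Variable K : fieldType.
Local Notation tofrac := (@FracField.tofrac {poly K}).
Implicit Types (P Q R : {poly {poly K}}) (q r : {poly {fraction {poly K}}}).

(** Reduction modulo the prime [z] of [K[z]]. *)
Definition red0 P : {poly K} := map_poly (horner_eval 0) P.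

Lemma red0M P Q : red0 (P * Q) = red0 P * red0 Q.
Proof. exact: rmorphM. Qed.

Lemma coef_red0 P i : (red0 P)`_i = P`_i`_0.
Proof. by rewrite coef_map /= /horner_eval horner_coef0. Qed.

Lemma tofrac_inj : injective tofrac.
Proof. by move=> x y /eqP; rewrite tofrac_eq => /eqP. Qed.

Lemma size_map_tofrac P : size (map_poly tofrac P) = size P.
Proof. by apply: size_map_inj_poly; [exact: tofrac_inj | exact: rmorph0]. Qed.

Lemma clear_denominators q : exists (c : {poly K}) Q,
  c != 0 /\ map_poly tofrac Q = tofrac c *: q.
Proof.
elim/poly_ind: q => [|q x [c [Q [c0 eqQ]]]].
  by exists 1, 0; rewrite oner_neq0 rmorph0 scaler0.
have [u [v [v0 ->]]] := fracP x.
exists (c * v), (v *: Q * 'X + (c * u)%:P); split; first by rewrite mulf_neq0.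
have cuE : tofrac (c * u) = tofrac (c * v) * (tofrac u / tofrac v).
  by rewrite !rmorphM -mulrA; congr (_ * _); rewrite mulrCA divff ?mulr1 ?tofrac_eq0.
rewrite rmorphD rmorphM /= map_polyZ /= map_polyX map_polyC /= eqQ cuE.
by rewrite scalerDr scalerA -rmorphM [v * c]mulrC -scalerAl polyCM mul_polyC.
Qed.

(** The exchange of the two variables makes this the splitting off of the root 0. *)
Lemma split_power Q : Q != 0 -> exists m Q', Q = ('X ^+ m) *: Q' /\ red0 Q' != 0.
Proof.
move=> Q0; have [m [S rS eqS]] := multiplicity_XsubC (swapXY Q) 0.
exists m, (swapXY S); split.
  rewrite -[LHS]swapXYK eqS subr0 rmorphM rmorphXn /= swapXY_X mulrC.
  by rewrite -polyC_exp mul_polyC.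
move: rS; rewrite swapXY_eq0 Q0 rootE -(rmorph0 (@polyC K)).
by rewrite -{1}[S]swapXYK horner_swapXY.
Qed.

Lemma red0Z (c : {poly K}) P : red0 (c *: P) = c`_0 *: red0 P.
Proof. by rewrite /red0 map_polyZ /= /horner_eval horner_coef0. Qed.

Lemma red0_XnZ m P : (0 < m)%N -> red0 ('X ^+ m *: P) = 0.
Proof. by move=> m0; rewrite red0Z coefXn; case: m m0 => // m _; rewrite scale0r. Qed.

(** Gauss's lemma localized at [z]: the factors keep their degrees and are
    integral up to a constant [c] prime to [z].  The power of [z] in the cleared
    denominators equals the one in the contents, because both [c *: P] and
    [Q * R] are nonzero modulo [z]. *)
Lemma factor_over_fractions P q r : red0 P != 0 -> map_poly tofrac P = q * r ->
  exists (c : {poly K}) Q R,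
    [/\ c`_0 != 0, c *: P = Q * R, size Q = size q & size R = size r].
Proof.
move=> P0 eqPqr.
have inj : injective (map_poly tofrac).
  by apply: map_inj_poly; [exact: tofrac_inj | exact: rmorph0].
have Pn0 : P != 0 by apply: contraNneq P0 => ->; rewrite /red0 rmorph0.
have : q * r != 0 by rewrite -eqPqr -size_poly_eq0 size_map_tofrac size_poly_eq0.
rewrite mulf_eq0 negb_or => /andP[q0 r0].
have norm q' : q' != 0 -> exists c m Q, [/\ c != 0, red0 Q != 0, size Q = size q' &
    map_poly tofrac ('X ^+ m *: Q) = tofrac c *: q'].
  move=> q'0; have [c [Q [c0 eqQ]]] := clear_denominators q'.
  have Q0 : Q != 0.
    by rewrite -size_poly_eq0 -size_map_tofrac eqQ size_scale ?tofrac_eq0 // size_poly_eq0.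
  have [m [Q' [eqQ' Q'0]]] := split_power Q0.
  exists c, m, Q'; rewrite -eqQ' eqQ; split=> //.
  have := congr1 (fun p => size (p : {poly _})) eqQ.
  by rewrite eqQ' size_map_tofrac !size_scale ?tofrac_eq0 // expf_neq0 // polyX_eq0.
have [c1 [m [Q [c10 Q0 szQ eqQ]]]] := norm q q0.
have [c2 [n [R [c20 R0 szR eqR]]]] := norm r r0.
have [k [c]] := multiplicity_XsubC (c1 * c2) 0.
rewrite mulf_neq0 // rootE horner_coef0 subr0 /= => c0 eqc.
have main : 'X ^+ k *: (c *: P) = 'X ^+ (m + n) *: (Q * R).
  have -> : 'X ^+ (m + n) *: (Q * R) = ('X ^+ m *: Q) * ('X ^+ n *: R).
    by rewrite -scalerAl -scalerAr scalerA -exprD.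
  apply: inj; rewrite [RHS]rmorphM /= eqQ eqR -scalerAl -scalerAr -eqPqr !scalerA.
  by rewrite -rmorphM eqc [c * _]mulrC map_polyZ.
exists c, Q, R; split=> //.
have Xn0 j : ('X ^+ j : {poly K}) != 0 by rewrite expf_neq0 // polyX_eq0.
have QR0 : red0 (Q * R) != 0 by rewrite red0M mulf_neq0.
have cP0 : red0 (c *: P) != 0 by rewrite red0Z scaler_eq0 negb_or c0.
have scaleXI j : injective ( *:%R ('X ^+ j : {poly K}) : {poly {poly K}} -> _).
  by move=> U V; rewrite -!mul_polyC; apply: mulfI; rewrite polyC_eq0.
have [lt|lt|eqk] := ltngtP k (m + n)%N.
- move: main; rewrite -(subnKC (ltnW lt)) exprD -scalerA => /scaleXI eqcP.
  by move: cP0; rewrite eqcP red0_XnZ ?eqxx // subn_gt0.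
- move: main; rewrite -(subnKC (ltnW lt)) exprD -scalerA => /scaleXI eqcP.
  by move: QR0; rewrite -eqcP red0_XnZ ?eqxx // subn_gt0.
by move: main; rewrite eqk => /scaleXI.
Qed.

Lemma coef1_eq0 (c l u v : {poly K}) : c`_0 != 0 -> c * l = u * v ->
  u`_0 = 0 -> v`_0 = 0 -> l`_1 = 0.
Proof.
move=> c0 eq u0 v0.
have := congr1 (fun p : {poly K} => p`_0) eq.
rewrite !coef0M u0 mul0r => /eqP; rewrite mulf_eq0 (negbTE c0) => /eqP l0.
have := congr1 (fun p : {poly K} => p`_1) eq.
rewrite !coefM !big_ord_recl !big_ord0 /= u0 v0 l0 mul0r !mulr0 !addr0 => /eqP.
by rewrite mulf_eq0 (negbTE c0) => /eqP.
Qed.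

Lemma size_red0 P : (size (red0 P) <= size P)%N.
Proof. exact: size_poly. Qed.

(** Modulo [z] the two factors are scalar multiples of powers of the variable, of
    the same degrees as the factors themselves; hence both constant terms vanish
    at [z = 0], and [z ^ 2] would divide the constant term of [P]. *)
Lemma eisenstein P n : (0 < n)%N -> size P = n.+1 ->
  (forall i, (i < n)%N -> P`_i`_0 = 0) -> P`_n`_0 != 0 -> P`_0`_1 != 0 ->
  irreducible_poly (map_poly tofrac P).
Proof.
move=> n0 szP Plt Pn P01.
have redP : red0 P = P`_n`_0 *: 'X^n.
  apply/polyP => i; rewrite coef_red0 coefZ coefXn.
  have [/Plt->|lt|->] := ltngtP i n; rewrite ?mulr0 ?mulr1 //.
  by rewrite [P`_i]nth_default ?szP // coef0.
have red0P : red0 P != 0.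
  by rewrite redP scaler_eq0 negb_or Pn -size_poly_eq0 size_polyXn.
apply: irreducible_no_factor => [|q r eqPqr q1 r1].
  by rewrite size_map_tofrac szP.
have [c [Q [R [c0 eqQR szQ szR]]]] := factor_over_fractions red0P eqPqr.
have redQR : red0 Q * red0 R = (c`_0 * P`_n`_0) *: 'X^n.
  by rewrite -red0M -eqQR red0Z redP scalerA.
have cP0 : c`_0 * P`_n`_0 != 0 by rewrite mulf_neq0.
have QR0 : red0 Q * red0 R != 0.
  by rewrite redQR scaler_eq0 negb_or cP0 -size_poly_eq0 size_polyXn.
have szQR : (size Q + size R = n.+2)%N.
  have Q0 : Q != 0 by rewrite -size_poly_gt0 szQ ltnW.
  have R0 : R != 0 by rewrite -size_poly_gt0 szR ltnW.
  have cn0 : c != 0 by apply: contraNneq c0 => ->; rewrite coef0.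
  have := size_mul Q0 R0; rewrite -eqQR size_scale // szP szQ szR.
  by move: q1 r1; move: (size q) (size r); clear; lia.
have root0 U V : red0 U * red0 V = (c`_0 * P`_n`_0) *: 'X^n ->
    red0 U * red0 V != 0 -> (size U + size V = n.+2)%N -> (1 < size U)%N -> U`_0`_0 = 0.
  move=> eqUV UV0 szUV U1; apply: contraTeq U1 => U00.
  have : 'X^n %| red0 V.
    rewrite -(@Gauss_dvdpr _ _ (red0 U)).
      by rewrite eqUV dvdpZr.
    by rewrite coprimep_expl // coprimep_sym coprimepX rootE horner_coef0 coef_red0.
  move/dvdp_leq; rewrite size_polyXn; move: UV0; rewrite mulf_eq0 negb_or.
  move=> /andP[_ V0] /(_ V0) /leq_trans /(_ (size_red0 V)).
  by move: szUV; move: (size U) (size V); clear; lia.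
have Q0 : Q`_0`_0 = 0 by apply: root0 redQR QR0 szQR _; rewrite szQ.
have R0 : R`_0`_0 = 0.
  rewrite mulrC in redQR QR0; rewrite addnC in szQR.
  by apply: root0 redQR QR0 szQR _; rewrite szR.
by case/eqP: P01; apply: coef1_eq0 c0 _ Q0 R0; rewrite -coefZ eqQR coef0M.
Qed.

(** The mirror image of [eisenstein]: modulo [z] the factors are constants, so
    that both leading coefficients vanish at [z = 0], and [z ^ 2] would divide the
    leading coefficient of [P]. *)
Lemma eisenstein_rev P : (1 < size P)%N ->
  (forall i, P`_i.+1`_0 = 0) -> P`_0`_0 != 0 -> (lead_coef P)`_1 != 0 ->
  irreducible_poly (map_poly tofrac P).
Proof.
move=> szP Pgt P0 lP.
have redP : red0 P = (P`_0`_0)%:P.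
  by apply/polyP => -[|i]; rewrite coef_red0 coefC //= Pgt.
have red0P : red0 P != 0 by rewrite redP polyC_eq0.
apply: irreducible_no_factor => [|q r eqPqr q1 r1].
  by rewrite size_map_tofrac.
have [c [Q [R [c0 eqQR szQ szR]]]] := factor_over_fractions red0P eqPqr.
have redQR : red0 Q * red0 R = (c`_0 * P`_0`_0)%:P.
  by rewrite -red0M -eqQR red0Z redP -mul_polyC polyCM.
have : size (red0 Q * red0 R) == 1%N by rewrite redQR size_polyC mulf_neq0.
rewrite size_mul_eq1 => /andP[/eqP sQ /eqP sR].
have lead0 U : size (red0 U) = 1%N -> (1 < size U)%N -> (lead_coef U)`_0 = 0.
  by move=> sU U1; rewrite lead_coefE -coef_red0 nth_default // sU -ltnS prednK // ltnW.
case/eqP: lP; apply: (coef1_eq0 c0 (u := lead_coef Q) (v := lead_coef R)).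
- by rewrite -lead_coefZ eqQR lead_coefM.
- by apply: lead0; rewrite ?szQ.
- by apply: lead0; rewrite ?szR.
Qed.

End Reduction.

Definition poly_quartic (K : fieldType) (p0 p1 p2 p3 p4 : {poly K})
    : {poly {poly K}} :=
  p4 *: 'X^4 + p3 *: 'X^3 + p2 *: 'X^2 + p1 *: 'X + p0%:P.

Lemma map_poly_quartic (K : fieldType) (p0 p1 p2 p3 p4 : {poly K}) :
  map_poly (@FracField.tofrac {poly K}) (poly_quartic p0 p1 p2 p3 p4) =
  quartic p0 p1 p2 p3 p4.
Proof.
by rewrite !rmorphD /= !map_polyZ /= !map_polyXn map_polyX map_polyC.
Qed.

Lemma coef_poly_quartic (K : fieldType) (p0 p1 p2 p3 p4 : {poly K}) i :
  (poly_quartic p0 p1 p2 p3 p4)`_i = [:: p0; p1; p2; p3; p4]`_i.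
Proof.
rewrite !coefD !coefZ !coefXn coefX coefC.
by case: i => [|[|[|[|[|i]]]]] /=;
  rewrite ?mulr0 ?mulr1 ?addr0 ?add0r // nth_nil.
Qed.

Lemma size_poly_quartic (K : fieldType) (p0 p1 p2 p3 p4 : {poly K}) :
  p4 != 0 -> size (poly_quartic p0 p1 p2 p3 p4) = 5.
Proof.
move=> p40; apply/eqP; rewrite eqn_leq; apply/andP; split.
  apply/leq_sizeP => -[|[|[|[|[|i]]]]] // _.
  by rewrite coef_poly_quartic /= nth_nil.
by apply: contraNltn p40 => /leq_sizeP/(_ 4 isT); rewrite coef_poly_quartic => /eqP.
Qed.

Theorem theorem2p1 :
  let z : {poly 'F_2} := 'X in
  let a := z in
  let b := z ^+ 2 + z + 1 in
  let t := thue_morse a b in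
  let tbar := thue_morse b a in
  let F2z_embedding := @frac_laurent 'F_2 in
  [/\ algebraicOver F2z_embedding (CF t),
      is_minimal_polynomial
        (quartic
           (z ^+ 9 + z ^+ 7 + z ^+ 6 + z ^+ 5 + z ^+ 4 + z + 1)
           (z ^+ 11 + z ^+ 10 + z ^+ 8 + z ^+ 6 + z ^+ 5 + z ^+ 3 + z ^+ 2 + z)
           (z ^+ 12 + z ^+ 10 + z ^+ 2)
           (z ^+ 11 + z ^+ 10 + z ^+ 8 + z ^+ 6 + z ^+ 5 + z ^+ 3 + z ^+ 2 + z)
           (z ^+ 10 + z ^+ 9 + z ^+ 7 + z ^+ 6 + z ^+ 5 + z ^+ 2 + z))
        (CF t),
      algebraicOver F2z_embedding (CF tbar)
    & is_minimal_polynomial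
        (quartic
           (z ^+ 9 + z ^+ 8 + z ^+ 7 + z ^+ 6 + z ^+ 5 + z ^+ 4 + z)
           (z ^+ 11 + z ^+ 10 + z ^+ 8 + z ^+ 6 + z ^+ 5 + z ^+ 3 + z ^+ 2 + z)
           (z ^+ 12 + z ^+ 10 + z ^+ 2)
           (z ^+ 11 + z ^+ 10 + z ^+ 8 + z ^+ 6 + z ^+ 5 + z ^+ 3 + z ^+ 2 + z)
           (z ^+ 10 + z ^+ 9 + z ^+ 8 + z ^+ 7 + z ^+ 6 + z ^+ 5 + z ^+ 2 + z + 1))
        (CF tbar)].
Proof.
move=> z a b t tbar F2z_embedding.
have two0 : 2%:R = 0 :> 'F_2 by exact: val_inj.
have two0p : 2%:R = 0 :> {poly 'F_2} by rewrite -(rmorph_nat (@polyC 'F_2)) two0 rmorph0.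
have sa : (1 < size a)%N by rewrite size_polyX.
have sb : size b = 3%N.
  by rewrite /b -addrA size_polyDl size_polyXn // -polyC1 size_XaddC.
have sb1 : (1 < size b)%N by rewrite sb.
have ab : a != b.
  by apply/eqP => /(congr1 (fun p : {poly _} => size p)); rewrite sb size_polyX.
have ba : b != a by rewrite eq_sym.
have eqS : a * b = z ^+ 3 + z ^+ 2 + z by rewrite /a /b; ring.
have eqE : a + b = z ^+ 2 + 1 by rewrite /a /b; ring_char2 two0p.
have eqQ2 : (a * b + (a + b)) ^+ 2 = z ^+ 6 + z ^+ 2 + 1.
  by rewrite eqS eqE; ring_char2 two0p.
have eqp1 : (a + b) * (a * b) * (a * b + (a + b)) ^+ 2 =
    z ^+ 11 + z ^+ 10 + z ^+ 8 + z ^+ 6 + z ^+ 5 + z ^+ 3 + z ^+ 2 + z.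
  by rewrite eqQ2 eqS eqE; ring_char2 two0p.
have eqp2 : (a * b) ^+ 2 * (a * b + (a + b)) ^+ 2 = z ^+ 12 + z ^+ 10 + z ^+ 2.
  by rewrite eqQ2 eqS; ring_char2 two0p.
have eqC : tm_coef a b =
    z ^+ 10 + z ^+ 9 + z ^+ 7 + z ^+ 6 + z ^+ 5 + z ^+ 2 + z.
  rewrite /tm_coef eqS eqE.
  have -> : (z ^+ 3 + z ^+ 2 + z + 1) * b + a = z ^+ 5 + z ^+ 3 + z ^+ 2 + z + 1.
    by rewrite /a /b; ring_char2 two0p.
  by rewrite /a; ring_char2 two0p.
have eqCbar : tm_coef b a =
    z ^+ 10 + z ^+ 9 + z ^+ 8 + z ^+ 7 + z ^+ 6 + z ^+ 5 + z ^+ 2 + z + 1.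
  rewrite /tm_coef [b * a]mulrC [b + a]addrC eqS eqE.
  have -> : (z ^+ 3 + z ^+ 2 + z + 1) * a + b = z ^+ 4 + z ^+ 3 + 1.
    by rewrite /a /b; ring_char2 two0p.
  by rewrite /b; ring_char2 two0p.
have eqp0 : tm_coef a b + (a + b) ^+ 2 * (a * b + (a + b)) ^+ 2 =
    z ^+ 9 + z ^+ 7 + z ^+ 6 + z ^+ 5 + z ^+ 4 + z + 1.
  by rewrite eqC eqQ2 eqE; ring_char2 two0p.
have eqp0bar : tm_coef b a + (a + b) ^+ 2 * (a * b + (a + b)) ^+ 2 =
    z ^+ 9 + z ^+ 8 + z ^+ 7 + z ^+ 6 + z ^+ 5 + z ^+ 4 + z.
  by rewrite eqCbar eqQ2 eqE; ring_char2 two0p.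
have := root_quartic_CF two0 ba sb1 sa.
have := root_quartic_CF two0 ab sa sb1.
rewrite [b * a]mulrC [b + a]addrC eqp0 eqp0bar eqp1 eqp2 eqC eqCbar.
set q := quartic _ _ _ _ _ => rt; set qbar := quartic _ _ _ _ _ => rtbar.
have irr : irreducible_poly q.
  rewrite /q -map_poly_quartic.
  have p4 : (z ^+ 10 + z ^+ 9 + z ^+ 7 + z ^+ 6 + z ^+ 5 + z ^+ 2 + z)`_1 != 0.
    by rewrite !coefD !coefXn coefX.
  have sz := size_poly_quartic _ _ _ _ (contraNneq _ p4).
  apply: eisenstein_rev.
  - by rewrite sz // => ->; rewrite coef0.
  - case=> [|[|[|[|i]]]]; rewrite coef_poly_quartic /= ?nth_nil ?coef0 //;
      by rewrite !coefD !coefXn ?coefX; exact: val_inj.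
  - by rewrite coef_poly_quartic /= !coefD !coefXn coefX coef1.
  by rewrite lead_coefE sz ?coef_poly_quartic // => ->; rewrite coef0.
have irrbar : irreducible_poly qbar.
  rewrite /qbar -map_poly_quartic; apply: (@eisenstein _ _ 4) => //.
  - apply: size_poly_quartic; apply/eqP => /(congr1 (fun p : {poly 'F_2} => p`_0)).
    by rewrite !coefD !coefXn coefX coef1 coef0.
  - case=> [|[|[|[|i]]]] // _; rewrite coef_poly_quartic /=;
      by rewrite !coefD !coefXn ?coefX; exact: val_inj.
  - by rewrite coef_poly_quartic /= !coefD !coefXn coefX coef1.
  by rewrite coef_poly_quartic /= !coefD !coefXn coefX.
split.
- by exists q; [exact: irredp_neq0 irr | exact: rt].
- exact: conj irr rt.
- by exists qbar; [exact: irredp_neq0 irrbar | exact: rtbar].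
- exact: conj irrbar rtbar.
Qed.
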